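(* $\mathsf{TS}^{!\omega} \leq_{\mathrm{sW}} \mathsf{FS}^{!\omega}$, and $\mathsf{RCA}_0 \vdash \mathsf{FS}^{!\omega} \to \mathsf{TS}^{!\omega}$.
   Context: For $X \subseteq \mathbb{N}$, $[X]^{!\omega}$ is the set of finite $s \subseteq X$ with $|s| = 1+\min s$. $\mathsf{TS}^{!\omega}$ is the problem/statement: for every coloring $f : [\mathbb{N}]^{!\omega} \to \mathbb{N}$ there is an infinite $H \subseteq \mathbb{N}$ with $f([H]^{!\omega}) \neq \mathbb{N}$ (instances: such $f$; solutions: such $H$). $\mathsf{FS}^{!\omega}$: for every coloring $f : [\mathbb{N}]^{!\omega} \to \mathbb{N}$ there is an infinite $H \subseteq \mathbb{N}$ such that for every $s \in [H]^{!\omega}$, $f(s) \notin H \setminus s$. $\mathsf{Q} \leq_{\mathrm{sW}} \mathsf{P}$ means there are Turing functionals $\Phi, \Psi$ such that for every instance $X$ of $\mathsf{Q}$, $\Phi(X)$ is an instance of $\mathsf{P}$ and for every solution $Y$ to $\mathsf{P}$ for $\Phi(X)$, $\Psi(Y)$ is a solution to $\mathsf{Q}$ for $X$. $\mathsf{RCA}_0$ is Robinson arithmetic plus $\Sigma^0_1$-induction and $\Delta^0_1$-comprehension. *)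

(* Defs.v *)
From Stdlib Require List.
From mathcomp Require Import all_boot.
From mathcomp Require Import finmap.

Set Implicit Arguments.
Unset Strict Implicit.
Unset Printing Implicit Defensive.

(* Turing functionals are given as codes of partial recursive functions with a
   function oracle; a code does not depend on the oracle. *)

Inductive orec : nat -> Type :=
| OZero n : orec n
| OSucc : orec 1
| OProj n : 'I_n -> orec n
| OOracle : orec 1
| OComp m n : orec m -> ('I_m -> orec n) -> orec n
| OPrim n : orec n -> orec n.+2 -> orec n.+1
| OMu n : orec n.+1 -> orec n.

(* [oeval p e v y] : the computation of [e] on input [v] with oracle [p]
   converges with value [y].  In the primitive recursion clause, [t] lists the
   successive values, the recursion argument being the first one. *)
Fixpoint oeval (p : nat -> nat) n (e : orec n) : n.-tuple nat -> nat -> Prop :=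
  match e in orec n return n.-tuple nat -> nat -> Prop with
  | OZero _ => fun _ y => y = 0
  | OSucc => fun v y => y = (thead v).+1
  | OProj _ i => fun v y => y = tnth v i
  | OOracle => fun v y => y = p (thead v)
  | OComp m _ g h => fun v y =>
      exists w : m.-tuple nat,
        (forall i, oeval p (h i) v (tnth w i)) /\ oeval p g w y
  | OPrim n g h => fun v y =>
      exists t : nat -> nat,
        [/\ oeval p g [tuple of behead v] (t 0),
            forall k, k < thead v ->
              oeval p h [tuple of k :: t k :: behead v] (t k.+1)
          & y = t (thead v)]
  | OMu n g => fun v y =>
      oeval p g [tuple of y :: v] 0 /\
      forall z, z < y -> exists r, oeval p g [tuple of z :: v] r.+1
  end.

Definition turing_functional := orec 1.

Definition maps_to (Phi : turing_functional) (p q : nat -> nat) : Prop :=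
  forall n, oeval p Phi [tuple n] (q n).

(* The two name maps present instances and candidate solutions as elements of
   Baire space, the form in which functionals read and write them. *)
Record problem := Problem {
  instance : Type;
  instance_name : instance -> nat -> nat;
  candidate : Type;
  candidate_name : candidate -> nat -> nat;
  solution : instance -> candidate -> Prop
}.

Definition sW_le (Q P : problem) : Prop :=
  exists Phi Psi : turing_functional, forall X : instance Q,
    exists2 X' : instance P,
      maps_to Phi (instance_name X) (instance_name X') &
      forall Y : candidate P, solution X' Y ->
        exists2 Z : candidate Q,
          maps_to Psi (candidate_name Y) (candidate_name Z) & solution X Z.

Definition fset_min (s : {fset nat}) : nat := head 0 (sort leq s).

(* [N]^{!omega}.  The junk value [fset_min fset0 = 0] is harmless, since
   the empty set does not have cardinality 1. *)
Definition exact_omega := {s : {fset nat} | #|` s| == 1 + fset_min s}.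

(* s \in [X]^{!omega} *)
Definition exact_omega_in (X : pred nat) (s : exact_omega) : Prop :=
  {subset val s <= X}.

Definition coloring := exact_omega -> nat.

Definition infinite_set (X : pred nat) : Prop := forall n, exists2 m, n < m & X m.

Definition set_name (X : pred nat) (n : nat) : nat := X n.

(* The finite set with canonical index c, i.e. c = \sum_(i in s) 2 ^ i. *)
Definition canonical_fset (c : nat) : {fset nat} :=
  [fset i in iota 0 c | odd (c %/ 2 ^ i)]%fset.

(* Canonical indices of sets outside the domain of [f] are mapped to 0. *)
Definition coloring_name (f : coloring) (c : nat) : nat :=
  if insub (canonical_fset c) is Some s then f s else 0.

Definition TS_solution (f : coloring) (H : pred nat) : Prop :=
  infinite_set H /\
  ~ (forall k, exists2 s : exact_omega, exact_omega_in H s & f s = k).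

Definition FS_solution (f : coloring) (H : pred nat) : Prop :=
  infinite_set H /\
  forall s : exact_omega, exact_omega_in H s ->
    ~ ((f s \in H) && (f s \notin val s)).

Definition TS_exact_omega : problem :=
  Problem coloring_name set_name TS_solution.

Definition FS_exact_omega : problem :=
  Problem coloring_name set_name FS_solution.

(* Number variables and set variables are two separate families of de Bruijn
   indices; set variables are the only set terms. *)
Inductive term :=
| Var of nat
| Zero
| Succ of term
| Add of term & term
| Mul of term & term.

Inductive form :=
| Eq of term & term
| Lt of term & term
| In of term & nat
| Bot
| Imp of form & form
| And of form & form
| Or of form & form
| All of form
| Ex of form
| AllS of form
| ExS of form.

Declare Scope l2_scope.
Delimit Scope l2_scope with l2.
Bind Scope l2_scope with term.
Bind Scope l2_scope with form.

Notation "'v0" := (Var 0) (at level 0) : l2_scope.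
Notation "'v1" := (Var 1) (at level 0) : l2_scope.
Notation "'v2" := (Var 2) (at level 0) : l2_scope.
Notation "'v3" := (Var 3) (at level 0) : l2_scope.
Notation "t .+1" := (Succ t) : l2_scope.
Notation "t + u" := (Add t u) : l2_scope.
Notation "t * u" := (Mul t u) : l2_scope.
Notation "t =' u" := (Eq t u) (at level 70, no associativity) : l2_scope.
Notation "t <' u" := (Lt t u) (at level 70, no associativity) : l2_scope.
Notation "t \in' X" := (In t X) (at level 70, no associativity) : l2_scope.
Notation "a -->' b" := (Imp a b) (at level 90, right associativity) : l2_scope.
Notation "a /\' b" := (And a b) (at level 80, right associativity) : l2_scope.
Notation "a \/' b" := (Or a b) (at level 85, right associativity) : l2_scope.
Notation "~' a" := (Imp a Bot) (at level 75, right associativity) : l2_scope.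
Notation "a <->' b" := (And (Imp a b) (Imp b a))
  (at level 95, no associativity) : l2_scope.

Definition scons T (x : T) (s : nat -> T) (n : nat) : T :=
  if n is m.+1 then s m else x.

Fixpoint tsubst (s : nat -> term) (t : term) : term :=
  match t with
  | Var n => s n
  | Zero => Zero
  | Succ t => Succ (tsubst s t)
  | Add t u => Add (tsubst s t) (tsubst s u)
  | Mul t u => Mul (tsubst s t) (tsubst s u)
  end.

(* Weakening by k number variables. *)
Definition tlift (k : nat) : term -> term := tsubst (fun n => Var (k + n)).

Notation "t ^^ k" := (tlift k t) (at level 8, left associativity) : l2_scope.

Fixpoint fsubst (s : nat -> term) (a : form) : form :=
  match a with
  | Eq t u => Eq (tsubst s t) (tsubst s u)
  | Lt t u => Lt (tsubst s t) (tsubst s u)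
  | In t X => In (tsubst s t) X
  | Bot => Bot
  | Imp a b => Imp (fsubst s a) (fsubst s b)
  | And a b => And (fsubst s a) (fsubst s b)
  | Or a b => Or (fsubst s a) (fsubst s b)
  | All a => All (fsubst (scons (Var 0) (fun n => tlift 1 (s n))) a)
  | Ex a => Ex (fsubst (scons (Var 0) (fun n => tlift 1 (s n))) a)
  | AllS a => AllS (fsubst s a)
  | ExS a => ExS (fsubst s a)
  end.

Fixpoint frenS (r : nat -> nat) (a : form) : form :=
  match a with
  | Eq t u => Eq t u
  | Lt t u => Lt t u
  | In t X => In t (r X)
  | Bot => Bot
  | Imp a b => Imp (frenS r a) (frenS r b)
  | And a b => And (frenS r a) (frenS r b)
  | Or a b => Or (frenS r a) (frenS r b)
  | All a => All (frenS r a)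
  | Ex a => Ex (frenS r a)
  | AllS a => AllS (frenS (scons 0 (fun n => (r n).+1)) a)
  | ExS a => ExS (frenS (scons 0 (fun n => (r n).+1)) a)
  end.

Definition inst (t : term) (a : form) : form := fsubst (scons t Var) a.
Definition instS (X : nat) (a : form) : form := frenS (scons X id) a.
Definition shift (a : form) : form := fsubst (fun n => Var n.+1) a.
Definition shiftS (a : form) : form := frenS succn a.

(* [ax] may contain open formulas; since the axiom rule is available under any
   eigenvariables, these stand for their universal closures. *)
Inductive prv (ax : form -> Prop) : seq form -> form -> Prop :=
| PAx G a : ax a -> prv ax G a
| PHyp G a : List.In a G -> prv ax G a
| PRaa G a : prv ax ((Imp a Bot) :: G) Bot -> prv ax G a
| PImpI G a b : prv ax (a :: G) b -> prv ax G (Imp a b)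
| PImpE G a b : prv ax G (Imp a b) -> prv ax G a -> prv ax G b
| PAndI G a b : prv ax G a -> prv ax G b -> prv ax G (And a b)
| PAndEl G a b : prv ax G (And a b) -> prv ax G a
| PAndEr G a b : prv ax G (And a b) -> prv ax G b
| POrIl G a b : prv ax G a -> prv ax G (Or a b)
| POrIr G a b : prv ax G b -> prv ax G (Or a b)
| POrE G a b c :
    prv ax G (Or a b) -> prv ax (a :: G) c -> prv ax (b :: G) c -> prv ax G c
| PAllI G a : prv ax (map shift G) a -> prv ax G (All a)
| PAllE G a t : prv ax G (All a) -> prv ax G (inst t a)
| PExI G a t : prv ax G (inst t a) -> prv ax G (Ex a)
| PExE G a c :
    prv ax G (Ex a) -> prv ax (a :: map shift G) (shift c) -> prv ax G c
| PAllSI G a : prv ax (map shiftS G) a -> prv ax G (AllS a)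
| PAllSE G a X : prv ax G (AllS a) -> prv ax G (instS X a)
| PExSI G a X : prv ax G (instS X a) -> prv ax G (ExS a)
| PExSE G a c :
    prv ax G (ExS a) -> prv ax (a :: map shiftS G) (shiftS c) -> prv ax G c
| PEqRefl G t : prv ax G (Eq t t)
| PEqE G a t u : prv ax G (Eq t u) -> prv ax G (inst t a) -> prv ax G (inst u a).

Definition provable (ax : form -> Prop) (a : form) : Prop := prv ax [::] a.

(* Delta^0_0 formulas; number and set parameters are allowed. *)
Inductive bounded : form -> Prop :=
| BEq t u : bounded (Eq t u)
| BLt t u : bounded (Lt t u)
| BIn t X : bounded (In t X)
| BBot : bounded Bot
| BImp a b : bounded a -> bounded b -> bounded (Imp a b)
| BAnd a b : bounded a -> bounded b -> bounded (And a b)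
| BOr a b : bounded a -> bounded b -> bounded (Or a b)
| BAll t a : bounded a -> bounded (All (Imp (Lt (Var 0) (tlift 1 t)) a))
| BEx t a : bounded a -> bounded (Ex (And (Lt (Var 0) (tlift 1 t)) a)).

Inductive Sigma01 : form -> Prop := Sigma01_ex a : bounded a -> Sigma01 (Ex a).
Inductive Pi01 : form -> Prop := Pi01_all a : bounded a -> Pi01 (All a).

(* Robinson arithmetic, with the usual definition of the order symbol. *)
Inductive robinson : form -> Prop :=
| QS0 : robinson (All (~' ('v0.+1 =' Zero)))
| QSinj : robinson (All (All ('v1.+1 =' 'v0.+1 -->' 'v1 =' 'v0)))
| Qpred : robinson (All ('v0 =' Zero \/' Ex ('v1 =' 'v0.+1)))
| Qadd0 : robinson (All ('v0 + Zero =' 'v0))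
| QaddS : robinson (All (All ('v1 + 'v0.+1 =' ('v1 + 'v0).+1)))
| Qmul0 : robinson (All ('v0 * Zero =' Zero))
| QmulS : robinson (All (All ('v1 * 'v0.+1 =' 'v1 * 'v0 + 'v1)))
| Qlt : robinson (All (All ('v1 <' 'v0 <->' Ex ('v0 + 'v2.+1 =' 'v1)))).

Definition induction (a : form) : form :=
  (inst Zero a /\' All (a -->' fsubst (scons 'v0.+1 (fun n => Var n.+1)) a)
   -->' All a)%l2.

(* The comprehension variable is number variable 0 of [a] and [b]; shifting the
   set variables of [a] makes the new set not free in it. *)
Definition comprehension (a b : form) : form :=
  (All (a <->' b) -->' ExS (All ('v0 \in' 0 <->' shiftS a)))%l2.

Inductive RCA0 : form -> Prop :=
| RCA0_Q a : robinson a -> RCA0 a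
| RCA0_induction a : Sigma01 a -> RCA0 (induction a)
| RCA0_comprehension a b : Sigma01 a -> Pi01 b -> RCA0 (comprehension a b).

Local Open Scope l2_scope.

(* Throughout, a parameter used below k number quantifiers is lifted by k. *)

Definition pair_tm (i j : term) : term := (i + j) * (i + j) + i.

Definition triple (s : term) : form :=
  Ex (Ex (Ex (s^^3 =' pair_tm 'v2 (pair_tm 'v1 'v0)))).

(* A triple s = (k, (m, n)) codes { x < k | m(x+1)+1 divides n }. *)
Definition elt (x s : term) : form :=
  Ex (Ex (Ex (s^^3 =' pair_tm 'v2 (pair_tm 'v1 'v0) /\' x^^3 <' 'v2 /\'
    Ex ('v1 =' ('v2 * (x^^4).+1).+1 * 'v0)))).

(* Finite sets are identified with their least codes. *)
Definition finset_code (s : term) : form :=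
  triple s /\'
  All ('v0 <' s^^1 -->' triple 'v0 -->'
       ~' All (elt 'v0 'v1 <->' elt 'v0 s^^2)).

(* Some finite t is (the graph of) a bijection from {i | i < n} onto s. *)
Definition card_eq (s n : term) : form :=
  Ex (finset_code 'v0 /\'
      All (elt 'v0 'v1 -->'
           Ex (Ex ('v2 =' pair_tm 'v1 'v0 /\' 'v1 <' n^^4 /\' elt 'v0 s^^4))) /\'
      All ('v0 <' n^^2 -->' Ex (elt (pair_tm 'v1 'v0) 'v2)) /\'
      All (All (All (elt (pair_tm 'v2 'v1) 'v3 -->'
                     elt (pair_tm 'v2 'v0) 'v3 -->' 'v1 =' 'v0))) /\'
      All (All (All (elt (pair_tm 'v2 'v0) 'v3 -->'
                     elt (pair_tm 'v1 'v0) 'v3 -->' 'v2 =' 'v1))) /\'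
      All (elt 'v0 s^^2 -->' Ex (elt (pair_tm 'v0 'v1) 'v2))).

(* s \in [N]^{!omega}; the existentially quantified number is min s. *)
Definition exact_omega_form (s : term) : form :=
  finset_code s /\'
  Ex (elt 'v0 s^^1 /\' All (elt 'v0 s^^2 -->' ~' ('v0 <' 'v1)) /\'
      card_eq s^^1 'v0.+1).

Definition exact_omega_in_form (X : nat) (s : term) : form :=
  exact_omega_form s /\' All (elt 'v0 s^^1 -->' 'v0 \in' X).

(* F is the set of pairs (s, f(s)) for some f : [N]^{!omega} -> N. *)
Definition coloring_form (F : nat) : form :=
  All ('v0 \in' F -->' Ex (Ex ('v2 =' pair_tm 'v1 'v0 /\' exact_omega_form 'v1))) /\'
  All (exact_omega_form 'v0 -->' Ex (pair_tm 'v1 'v0 \in' F)) /\'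
  All (All (All (pair_tm 'v2 'v1 \in' F -->' pair_tm 'v2 'v0 \in' F -->'
                 'v1 =' 'v0))).

Definition infinite_form (X : nat) : form := All (Ex ('v1 <' 'v0 /\' 'v0 \in' X)).

(* Below [ExS], set variable 0 is H and set variable 1 is the coloring. *)
Definition TS_form : form :=
  AllS (coloring_form 0 -->'
    ExS (infinite_form 0 /\'
         ~' All (Ex (exact_omega_in_form 0 'v0 /\' pair_tm 'v0 'v1 \in' 1)))).

Definition FS_form : form :=
  AllS (coloring_form 0 -->'
    ExS (infinite_form 0 /\'
         All (All (exact_omega_in_form 0 'v1 -->' pair_tm 'v1 'v0 \in' 1 -->'
                   ~' ('v0 \in' 0 /\' ~' elt 'v0 'v1))))).

(* Main.v *)
Require Import Defs.
From mathcomp Require Import all_boot.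

Set Implicit Arguments.
Unset Strict Implicit.
Unset Printing Implicit Defensive.

(** If [H] is free for [f] and [a] is an element of [H], then no [s] contained
    in [H' := H \ {a}] has colour [a], since [a] would be an element of [H]
    outside [s].  So [f] is its own FS-instance.  The Turing functional takes
    [a := min H], so that [x] is in [H'] iff [x] is in [H] and some [y < x] is;
    the formal proof takes any [a] and gets [H'] by quantifier-free
    comprehension.  There, infinity of [H'] is the only arithmetical point: if
    the element of [H] found above [n] is [a] itself, then any element above
    [a] will do, which uses transitivity and irreflexivity of the order. *)

(** * The strong Weihrauch reduction *)

(** Recursion on the first bit: 0 at stage 0, and from then on the second bit, which has index 2 in
    the step's input [(k, t k, c)]. *)
Definition and_code : orec 2 := OPrim (OZero 1) (OProj (inord 2 : 'I_3)).

Definition or_code : orec 2 :=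
  OPrim (OProj (ord0 : 'I_1)) (OComp OSucc (fun _ : 'I_1 => OZero 3)).

(** The recursion or-s the oracle's bit at [k] into the running value. The search is bounded, so
    [OMu] is avoided and the code converges on every oracle. *)
Definition seen_code : orec 1 :=
  OPrim (OZero 0)
    (OComp or_code (fun i : 'I_2 =>
       if i == ord0 then OComp OOracle (fun _ : 'I_1 => OProj (ord0 : 'I_2))
       else OProj (inord 1 : 'I_2))).

Definition remove_min_code : turing_functional :=
  OComp and_code (fun i : 'I_2 => if i == ord0 then OOracle else seen_code).

Definition remove_min (Y : pred nat) : pred nat :=
  fun n => Y n && has Y (iota 0 n).

Lemma oeval_and (p : nat -> nat) (b c : bool) :
  oeval p and_code [tuple b : nat; c : nat] (b && c).
Proof.
exists (fun k => (0 < k) && c); split=> [|k _|] //=; last by case: b.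
by rewrite (tnth_nth 0) inordK.
Qed.

Lemma oeval_or (p : nat -> nat) (b c : bool) :
  oeval p or_code [tuple b : nat; c : nat] (b || c).
Proof.
exists (fun k => (0 < k) || c); split=> [|k _|] //=; last by case: b.
by exists [tuple 0]; split=> // i; rewrite (tnth_nth 0) ord1.
Qed.

Lemma oeval_seen (Y : pred nat) (n : nat) :
  oeval (set_name Y) seen_code [tuple n] (has Y (iota 0 n)).
Proof.
exists (fun k => has Y (iota 0 k)); split=> // k _.
exists [tuple Y k : nat; has Y (iota 0 k) : nat]; split; last first.
  have -> : has Y (iota 0 k.+1) = Y k || has Y (iota 0 k).
    by rewrite -addn1 iotaD has_cat /= orbF orbC.
  exact: oeval_or.
move=> i; case: eqP => [->|/eqP i_neq0] /=.
  by exists [tuple k]; split=> // j; rewrite ord1 !(tnth_nth 0).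
have i1 : i = 1 :> nat by case: i i_neq0 => [[|[|]]].
by rewrite !(tnth_nth 0) inordK // i1.
Qed.

Lemma maps_to_remove_min (Y : pred nat) :
  maps_to remove_min_code (set_name Y) (set_name (remove_min Y)).
Proof.
move=> n; exists [tuple Y n : nat; has Y (iota 0 n) : nat].
split; last exact: oeval_and.
move=> i; case: eqP => [->|/eqP i_neq0] //.
have i1 : i = 1 :> nat by case: i i_neq0 => [[|[|]]].
by rewrite (tnth_nth 0) i1; exact: oeval_seen.
Qed.

Lemma infinite_remove_min (Y : pred nat) :
  infinite_set Y -> infinite_set (remove_min Y).
Proof.
(* Any element above a fixed [b] in [Y] survives, with [b] as the smaller element that the test asks
   for. *)
move=> infY n; have [b _ Yb] := infY 0; have [m lt_m Ym] := infY (maxn n b).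
move: lt_m; rewrite gtn_max => /andP[lt_nm lt_bm]; exists m => //.
by rewrite /remove_min Ym; apply/hasP; exists b; rewrite ?mem_iota.
Qed.

Lemma FS_solution_remove_min (f : coloring) (Y : pred nat) :
  FS_solution f Y -> TS_solution f (remove_min Y).
Proof.
move=> [infY freeY]; split=> [|onto]; first exact: infinite_remove_min.
have exY : exists a, Y a by have [a _ Ya] := infY 0; exists a.
case: (ex_minnP exY) => a Ya minY.
have [s sY fsa] := onto a.
apply: (freeY s) => [x /sY /andP[] //|]; rewrite fsa.
(* Were [a] in [s], it would pass the test of [remove_min], against its minimality in [Y]. *)
apply/andP; split=> //; apply/negP => /sY /andP[_ /hasP[b]].
by rewrite mem_iota => /andP[_ lt_ba] /minY; rewrite leqNgt lt_ba.
Qed.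

Lemma TS_sW_le_FS : sW_le TS_exact_omega FS_exact_omega.
Proof.
exists OOracle, remove_min_code => f; exists f => // Y solY.
by exists (remove_min Y); [exact: maps_to_remove_min
                          | exact: FS_solution_remove_min].
Qed.

(** * Substitution *)

Lemma tsubst_comp s r t :
  tsubst s (tsubst r t) = tsubst (fun n => tsubst s (r n)) t.
Proof. by elim: t => //= [t ->|t -> u ->|t -> u ->]. Qed.

Lemma tsubst_ext s r t : s =1 r -> tsubst s t = tsubst r t.
Proof. by move=> sr; elim: t => //= [t ->|t -> u ->|t -> u ->]. Qed.

Lemma tsubst_Var t : tsubst Var t = t.
Proof. by elim: t => //= [t ->|t -> u ->|t -> u ->]. Qed.

Lemma tsubst_tlift1 s t : tsubst s (tlift 1 t) = tsubst (fun n => s n.+1) t.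
Proof. exact: tsubst_comp. Qed.

Lemma tlift1K u t : tsubst (scons u Var) (tlift 1 t) = t.
Proof. by rewrite tsubst_tlift1 tsubst_Var. Qed.

(** For induction steps: replacing the induction variable leaves lifted parameters alone. *)
Lemma tsubst_step_tlift1 u t :
  tsubst (scons u (fun n => Var n.+1)) (tlift 1 t) = tlift 1 t.
Proof. by rewrite tsubst_tlift1. Qed.

(** Up to a vacuous quantifier, induction and comprehension are applied to such formulas only.
    Having no binders, they inherit the substitution laws of terms directly. *)
Fixpoint quantifier_free (a : form) : bool :=
  match a with
  | Eq _ _ | Lt _ _ | In _ _ | Bot => true
  | Imp a b | And a b | Or a b => quantifier_free a && quantifier_free b
  | _ => false
  end.

Lemma quantifier_free_bounded a : quantifier_free a -> bounded a.
Proof.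
by elim: a => //= *; try constructor; do ?[match goal with
  H : is_true (_ && _) |- _ => case/andP: H => ? ? end]; auto.
Qed.

Lemma quantifier_free_fsubst s a :
  quantifier_free (fsubst s a) = quantifier_free a.
Proof. by elim: a s => //= a IHa b IHb s; rewrite IHa IHb. Qed.

Lemma fsubst_comp s r a : quantifier_free a ->
  fsubst s (fsubst r a) = fsubst (fun n => tsubst s (r n)) a.
Proof.
by elim: a => //= [t u _|t u _|t X _|a IHa b IHb|a IHa b IHb|a IHa b IHb];
  rewrite ?tsubst_comp // => /andP[/IHa -> /IHb ->].
Qed.

Lemma fsubst_ext s r a : quantifier_free a -> s =1 r -> fsubst s a = fsubst r a.
Proof.
move=> qf sr; elim: a qf => //=
  [t u _|t u _|t X _|a IHa b IHb|a IHa b IHb|a IHa b IHb];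
  rewrite ?(tsubst_ext _ sr) // => /andP[/IHa -> /IHb ->] //.
Qed.

Lemma fsubst_Var a : quantifier_free a -> fsubst Var a = a.
Proof.
by elim: a => //= [t u _|t u _|t X _|a IHa b IHb|a IHa b IHb|a IHa b IHb];
  rewrite ?tsubst_Var // => /andP[/IHa -> /IHb ->].
Qed.

Lemma inst_shift t a : quantifier_free a -> inst t (shift a) = a.
Proof. by move=> qf; rewrite /inst /shift fsubst_comp // fsubst_Var. Qed.

Lemma fsubst_Ex_shift s a : quantifier_free a ->
  fsubst s (Ex (shift a)) = Ex (shift (fsubst s a)).
Proof.
by move=> qf; rewrite /= /shift !fsubst_comp //; congr Ex; apply: fsubst_ext.
Qed.

(** * Derived rules *)

(** In the [_eq] rules an equation ties the instance to the goal, which need not literally have the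
    form [inst t a]. *)
Lemma PAllE_eq ax G a t b : prv ax G (All a) -> inst t a = b -> prv ax G b.
Proof. by move=> H <-; apply: PAllE. Qed.

Lemma PAllE2_eq ax G a t u b : prv ax G (All (All a)) ->
  inst u (fsubst (scons (Var 0) (fun n => tlift 1 (scons t Var n))) a) = b ->
  prv ax G b.
Proof. by move=> H <-; apply: PAllE; apply: (PAllE t H). Qed.

Lemma PExI_eq ax G a t b : prv ax G b -> inst t a = b -> prv ax G (Ex a).
Proof. by move=> H E; apply: (@PExI _ _ _ t); rewrite E. Qed.

Lemma PEqE_eq ax G a t u b c :
  prv ax G (Eq t u) -> prv ax G b -> inst t a = b -> inst u a = c -> prv ax G c.
Proof. by move=> H Hb Eb <-; apply: PEqE H _; rewrite Eb. Qed.

Lemma excluded_middle ax G a : prv ax G (Or a (Imp a Bot)).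
Proof.
apply: PRaa.
apply: (@PImpE _ _ (Or a (Imp a Bot))); first by apply: PHyp; left.
apply: POrIr; apply: PImpI.
apply: (@PImpE _ _ (Or a (Imp a Bot))); first by apply: PHyp; right; left.
by apply: POrIl; apply: PHyp; left.
Qed.

Lemma prv_eq_sym ax G t u : prv ax G (Eq t u) -> prv ax G (Eq u t).
Proof.
(* Leibniz's rule for the predicate [x = t] of [x], starting from [t = t]. *)
move=> H; apply: (@PEqE_eq _ _ (Eq (Var 0) (tlift 1 t)) _ _ _ _ H (PEqRefl _ _ t));
by rewrite /inst /= tlift1K.
Qed.

Lemma prv_eq_trans ax G u t w :
  prv ax G (Eq t u) -> prv ax G (Eq u w) -> prv ax G (Eq t w).
Proof.
move=> H1 H2; apply: (@PEqE_eq _ _ (Eq (tlift 1 t) (Var 0)) _ _ _ _ H2 H1);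
by rewrite /inst /= tlift1K.
Qed.

Lemma prv_eq_Succ ax G t u :
  prv ax G (Eq t u) -> prv ax G (Eq (Succ t) (Succ u)).
Proof.
move=> H; apply: (@PEqE_eq _ _ (Eq (Succ (tlift 1 t)) (Succ (Var 0))) _ _ _ _ H
  (PEqRefl _ _ (Succ t))); by rewrite /inst /= tlift1K.
Qed.

Lemma prv_eq_Addr ax G w t u :
  prv ax G (Eq t u) -> prv ax G (Eq (Add w t) (Add w u)).
Proof.
move=> H; apply: (@PEqE_eq _ _ (Eq (tlift 1 (Add w t)) (Add (tlift 1 w) (Var 0)))
  _ _ _ _ H (PEqRefl _ _ (Add w t)));
by rewrite /inst /= -!/(tlift 1 _) !tlift1K.
Qed.

Lemma prv_Ex_shift_intro ax G a :
  quantifier_free a -> prv ax G a -> prv ax G (Ex (shift a)).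
Proof. by move=> qf H; apply: (PExI_eq H (inst_shift Zero qf)). Qed.

Lemma prv_Ex_shift_elim ax G a : prv ax G (Ex (shift a)) -> prv ax G a.
Proof. by move=> H; apply: (PExE H); apply: PHyp; left. Qed.

(** * Arithmetic in RCA0 *)

(* The axioms speak of Sigma01 formulas, which begin with an unbounded
   quantifier: a quantifier-free formula needs a vacuous one. *)
Lemma quantifier_free_induction G b t : quantifier_free b ->
  prv RCA0 G (inst Zero b) ->
  (forall G', prv RCA0 G' b ->
     prv RCA0 G' (fsubst (scons (Succ (Var 0)) (fun n => Var n.+1)) b)) ->
  prv RCA0 G (inst t b).
Proof.
move=> qf H0 HS; apply: prv_Ex_shift_elim.
have qfs := quantifier_free_fsubst.
have bnd : bounded (shift b).
  by apply: quantifier_free_bounded; rewrite /shift qfs.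
apply: (@PAllE_eq _ _ (Ex (shift b)) t); last exact: fsubst_Ex_shift.
apply: PImpE (PAx _ (RCA0_induction (Sigma01_ex bnd))) _; apply: PAndI.
  rewrite /inst fsubst_Ex_shift //; apply: prv_Ex_shift_intro => //.
  by rewrite qfs.
(* Generalization shifts the context and the induction hypothesis extends it, hence [HS] for every
   [G']. *)
apply: PAllI; apply: PImpI; rewrite fsubst_Ex_shift //.
apply: prv_Ex_shift_intro; first by rewrite qfs.
by apply: HS; apply: prv_Ex_shift_elim; apply: PHyp; left.
Qed.

Lemma quantifier_free_comprehension G b : quantifier_free b ->
  prv RCA0 G (ExS (All (And (Imp (In (Var 0) 0) (shiftS (Ex (shift b))))
                            (Imp (shiftS (Ex (shift b))) (In (Var 0) 0))))).
Proof.
move=> qf; have qfs : quantifier_free (shift b).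
  by rewrite /shift quantifier_free_fsubst.
have bnd := quantifier_free_bounded qfs.
(* One matrix under a vacuous [Ex] and a vacuous [All] serves as both the Sigma01 and the Pi01
   formula. *)
apply: PImpE (PAx _ (RCA0_comprehension (Sigma01_ex bnd) (Pi01_all bnd))) _.
apply: PAllI; apply: PAndI; apply: PImpI.
  apply: PAllI; apply: prv_Ex_shift_elim; apply: PHyp; left.
  exact: fsubst_Ex_shift.
apply: prv_Ex_shift_intro => //.
by apply: (@PAllE_eq _ _ (shift b) Zero); [apply: PHyp; left | exact: inst_shift].
Qed.

Lemma prv_Add0 G t : prv RCA0 G (Eq (Add t Zero) t).
Proof. exact: (PAllE t (PAx G (RCA0_Q Qadd0))). Qed.

Lemma prv_AddS G t u : prv RCA0 G (Eq (Add t (Succ u)) (Succ (Add t u))).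
Proof.
apply: (PAllE2_eq (t := t) (u := u) (PAx G (RCA0_Q QaddS))).
by rewrite /inst /= tlift1K.
Qed.

Lemma prv_Succ_inj G t u :
  prv RCA0 G (Eq (Succ t) (Succ u)) -> prv RCA0 G (Eq t u).
Proof.
apply: PImpE; apply: (PAllE2_eq (t := t) (u := u) (PAx G (RCA0_Q QSinj))).
by rewrite /inst /= tlift1K.
Qed.

Lemma prv_Succ_neq0 G t : prv RCA0 G (Eq (Succ t) Zero) -> prv RCA0 G Bot.
Proof. by apply: PImpE; apply: (PAllE t (PAx G (RCA0_Q QS0))). Qed.

(** Associativity as needed for transitivity of the order. With the successor built in, induction on
    [t] never has to move a successor out of a left summand. *)
Lemma prv_Succ_AddA G l k t :
  prv RCA0 G (Eq (Succ (Add l (Add k t))) (Add (Succ (Add l k)) t)).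
Proof.
pose l1 := tlift 1 l; pose k1 := tlift 1 k.
pose b := Eq (Succ (Add l1 (Add k1 (Var 0)))) (Add (Succ (Add l1 k1)) (Var 0)).
have instb u : inst u b = Eq (Succ (Add l (Add k u))) (Add (Succ (Add l k)) u).
  by rewrite /inst /= !tlift1K.
rewrite -instb; apply: quantifier_free_induction => // [|G' IH].
  rewrite instb; apply: prv_eq_trans (prv_eq_sym (prv_Add0 _ _)).
  by apply: prv_eq_Succ; apply: prv_eq_Addr; apply: prv_Add0.
rewrite /= !tsubst_step_tlift1 -/l1 -/k1.
apply: prv_eq_trans (prv_eq_sym (prv_AddS _ _ _)).
apply: prv_eq_Succ; apply: prv_eq_trans IH.
by apply: prv_eq_trans (prv_AddS _ _ _); apply: prv_eq_Addr; apply: prv_AddS.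
Qed.

(** Irreflexivity of the order, unfolded. Induction on [t] peels a successor off both sides. *)
Lemma prv_Add_Succ_neq G k t :
  prv RCA0 G (Eq (Add k (Succ t)) t) -> prv RCA0 G Bot.
Proof.
pose k1 := tlift 1 k; pose b := Imp (Eq (Add k1 (Succ (Var 0))) (Var 0)) Bot.
have instb u : inst u b = Imp (Eq (Add k (Succ u)) u) Bot.
  by rewrite /inst /= !tlift1K.
apply: PImpE; rewrite -instb; apply: quantifier_free_induction => // [|G' IH].
  rewrite instb; apply: PImpI; apply: (@prv_Succ_neq0 _ (Add k Zero)).
  by apply: prv_eq_trans (prv_eq_sym (prv_AddS _ _ _)) _; apply: PHyp; left.
rewrite /= !tsubst_step_tlift1 -/k1; apply: PImpE IH; do 2!apply: PImpI.
apply: (@PImpE _ _ (Eq (Add k1 (Succ (Var 0))) (Var 0))).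
  by apply: PHyp; right; left.
apply: prv_Succ_inj; apply: prv_eq_trans (prv_eq_sym (prv_AddS _ _ _)) _.
by apply: PHyp; left.
Qed.

Lemma prv_lt_Var G i j :
  prv RCA0 G (And
    (Imp (Lt (Var i) (Var j))
         (Ex (Eq (Add (Var 0) (Succ (Var i.+1))) (Var j.+1))))
    (Imp (Ex (Eq (Add (Var 0) (Succ (Var i.+1))) (Var j.+1)))
         (Lt (Var i) (Var j)))).
Proof. by apply: (PAllE2_eq (t := Var i) (u := Var j) (PAx G (RCA0_Q Qlt))). Qed.

Lemma prv_lt_irrefl G i : prv RCA0 G (Lt (Var i) (Var i)) -> prv RCA0 G Bot.
Proof.
move=> /(PImpE (PAndEl (prv_lt_Var G i i))) H.
by apply: PExE H _; apply: prv_Add_Succ_neq; apply: PHyp; left.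
Qed.

Lemma prv_lt_trans G i j k :
  prv RCA0 G (Lt (Var i) (Var j)) -> prv RCA0 G (Lt (Var j) (Var k)) ->
  prv RCA0 G (Lt (Var i) (Var k)).
Proof.
move=> /(PImpE (PAndEl (prv_lt_Var G i j))) Hij.
move=> /(PImpE (PAndEl (prv_lt_Var G j k))) Hjk.
apply: PImpE (PAndEr (prv_lt_Var G i k)) _.
apply: PImpE Hjk; apply: PExE Hij _; apply: PImpI.
apply: PExE; first by apply: PHyp; left.
pose z := Add (Var 0) (Succ (Var j.+2)).
(* From [y + S i = j] and [x + S j = k] follows [S (x + y) + S i = k]; [x] is [Var 0] and [y] is
   [Var 1]. *)
apply: (@PExI_eq _ _ _ (Succ (Add (Var 0) (Var 1)))); last by [].
rewrite /inst /=.
apply: prv_eq_trans (prv_eq_sym (prv_Succ_AddA _ _ _ _)) _.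
apply: prv_eq_trans (prv_eq_sym (prv_AddS _ _ _)) _.
apply: (@prv_eq_trans _ _ z); last by apply: PHyp; left.
apply: prv_eq_Addr; apply: prv_eq_Succ.
by apply: PHyp; right; right; left.
Qed.

(** * The formal reduction *)

(** The clause of [FS_form] on the solution, with its set variables as parameters; [onto_form] is
    likewise the clause negated in [TS_form]. *)
Definition free_form (H F : nat) : form :=
  All (All (Imp (exact_omega_in_form H (Var 1))
    (Imp (In (pair_tm (Var 1) (Var 0)) F)
      (Imp (And (In (Var 0) H) (Imp (elt (Var 0) (Var 1)) Bot)) Bot)))).

Definition onto_form (H F : nat) : form :=
  All (Ex (And (exact_omega_in_form H (Var 0))
               (In (pair_tm (Var 0) (Var 1)) F))).

(* x \in H \ {a} *)
Definition remove_form (H : nat) (a x : term) : form :=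
  And (In x H) (Imp (Eq x a) Bot).

(* H' = H \ {a}, in the shape given by quantifier_free_comprehension *)
Definition remove_axiom (H' H a : nat) : form :=
  All (And (Imp (In (Var 0) H') (Ex (remove_form H (Var a.+2) (Var 1))))
           (Imp (Ex (remove_form H (Var a.+2) (Var 1))) (In (Var 0) H'))).

Lemma prv_remove_elim G H' H a i :
  prv RCA0 G (remove_axiom H' H a) -> prv RCA0 G (In (Var i) H') ->
  prv RCA0 G (remove_form H (Var a) (Var i)).
Proof.
move=> HC Hi; apply: prv_Ex_shift_elim; apply: PImpE Hi; apply: PAndEl.
by apply: (PAllE_eq (t := Var i) HC).
Qed.

Lemma prv_remove_intro G H' H a i :
  prv RCA0 G (remove_axiom H' H a) ->
  prv RCA0 G (remove_form H (Var a) (Var i)) -> prv RCA0 G (In (Var i) H').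
Proof.
move=> HC Hi; apply: (PImpE _ (prv_Ex_shift_intro _ Hi)) => //; apply: PAndEr.
by apply: (PAllE_eq (t := Var i) HC).
Qed.

Ltac hyp n :=
  apply: PHyp; lazymatch n with
  | 0 => by left
  | 1 => by right; left
  | 2 => by do 2!right; left
  | 3 => by do 3!right; left
  | 4 => by do 4!right; left
  | 5 => by do 5!right; left
  end.

Lemma prv_infinite_elim G X i c :
  prv RCA0 G (infinite_form X) ->
  prv RCA0 (And (Lt (Var i.+1) (Var 0)) (In (Var 0) X) :: map shift G) (shift c) ->
  prv RCA0 G c.
Proof.
by move=> HI; apply: PExE; apply: (PAllE_eq (t := Var i) HI).
Qed.

Lemma prv_infinite_remove G H' H a :
  prv RCA0 G
    (Imp (infinite_form H) (Imp (remove_axiom H' H a) (infinite_form H'))).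
Proof.
do 2!apply: PImpI; apply: PAllI.
apply: (@prv_infinite_elim _ H 0); first by hyp 1.
(* [Var 0] is the element found above the bound [Var 1]. If it is not the removed element
   [Var a.+2], it is the witness. *)
apply: (POrE (excluded_middle _ _ (Eq (Var 0) (Var a.+2)))); last first.
  apply: (@PExI_eq _ _ _ (Var 0)); last by [].
  apply: PAndI; first by apply: PAndEl; hyp 1.
  apply: (@prv_remove_intro _ _ H a.+2); first by hyp 2.
  by apply: PAndI; [apply: PAndEr; hyp 1 | hyp 0].
(* From here on [Var 0] is the new element, [Var 1] the removed one just found, and [Var 2] the
   bound. *)
apply: (@prv_infinite_elim _ H 0); first by hyp 3.
apply: (@PExI_eq _ _ _ (Var 0)); last by [].
apply: PAndI.
  apply: (@prv_lt_trans _ 2 1 0); first by apply: PAndEl; hyp 2.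
  by apply: PAndEl; hyp 0.
apply: (@prv_remove_intro _ _ H a.+3); first by hyp 3.
apply: PAndI; first by apply: PAndEr; hyp 0.
apply: PImpI; apply: (@prv_lt_irrefl _ 1).
apply: (@PEqE_eq _ _ (Lt (Var 2) (Var 0)) (Var 0) (Var 1) (Lt (Var 1) (Var 0))) => //.
  apply: (@prv_eq_trans _ _ (Var a.+3)); first by hyp 0.
  by apply: prv_eq_sym; hyp 2.
by apply: PAndEl; hyp 1.
Qed.

(** The cardinality condition does not mention the set, so only the clause on elements changes. *)
Lemma prv_exact_omega_in_sub G X Y i :
  prv RCA0 G (Imp (All (Imp (In (Var 0) X) (In (Var 0) Y)))
    (Imp (exact_omega_in_form X (Var i)) (exact_omega_in_form Y (Var i)))).
Proof.
do 2!apply: PImpI; apply: PAndI; first by apply: PAndEl; hyp 0.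
apply: PAllI; apply: PImpI; apply: (@PImpE _ _ (In (Var 0) X)).
  apply: (@PAllE_eq _ _ (Imp (In (Var 0) X) (In (Var 0) Y)) (Var 0)) => //.
  by hyp 2.
apply: (@PImpE _ _ (elt (Var 0) (Var i.+1))); last by hyp 0.
apply: (@PAllE_eq _ _ (Imp (elt (Var 0) (Var i.+2)) (In (Var 0) X)) (Var 0)) => //.
by apply: PAndEr; hyp 1.
Qed.

Lemma prv_remove_not_onto G H' H F a :
  prv RCA0 G (Imp (remove_axiom H' H a) (Imp (free_form H F)
    (Imp (In (Var a) H) (Imp (onto_form H' F) Bot)))).
Proof.
do 4!apply: PImpI.
apply: (@PExE _ _ (And (exact_omega_in_form H' (Var 0))
                       (In (pair_tm (Var 0) (Var a.+1)) F))).
  by apply: (@PAllE_eq _ _ _ (Var a)); first by hyp 0.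
apply: (@PImpE _ _ (And (In (Var a.+1) H) (Imp (elt (Var a.+1) (Var 0)) Bot))).
  apply: (@PImpE _ _ (In (pair_tm (Var 0) (Var a.+1)) F)); last first.
    by apply: PAndEr; hyp 0.
  apply: (@PImpE _ _ (exact_omega_in_form H (Var 0))).
    by apply: (@PAllE2_eq _ _ _ (Var 0) (Var a.+1)); first by hyp 3.
  apply: (@PImpE _ _ (exact_omega_in_form H' (Var 0))).
    apply: PImpE (prv_exact_omega_in_sub _ _ _ _) _.
    apply: PAllI; apply: PImpI; apply: PAndEl.
    by apply: (@prv_remove_elim _ H' H a.+2); [hyp 5 | hyp 0].
  by apply: PAndEl; hyp 0.
apply: PAndI; first by hyp 2.
(* If the removed element were in [s], it would be in [H'] and so differ from itself. *)
apply: PImpI; apply: (@PImpE _ _ (Eq (Var a.+1) (Var a.+1))); last exact: PEqRefl.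
apply: PAndEr; apply: (@prv_remove_elim _ H' H); first by hyp 5.
apply: (@PImpE _ _ (elt (Var a.+1) (Var 0))); last by hyp 0.
apply: (@PAllE_eq _ _ (Imp (elt (Var 0) (Var 1)) (In (Var 0) H')) (Var a.+1)) => //.
by apply: PAndEr; apply: PAndEl; hyp 1.
Qed.

Lemma RCA0_FS_TS : provable RCA0 (Imp FS_form TS_form).
Proof.
apply: PImpI; apply: PAllSI; apply: PImpI.
apply: (@PExSE _ _ (And (infinite_form 0) (free_form 0 1))).
  apply: (@PImpE _ _ (coloring_form 0)); last by hyp 0.
  by apply: (@PAllSE _ _ (Imp (coloring_form 0)
    (ExS (And (infinite_form 0) (free_form 0 1)))) 0); hyp 1.
(* Infinity above [Zero] serves to name an element of [H] to remove. *)
apply: (@PExE _ _ (And (Lt Zero (Var 0)) (In (Var 0) 0))).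
  apply: (@PAllE_eq _ _ (Ex (And (Lt (Var 1) (Var 0)) (In (Var 0) 0))) Zero) => //.
  by apply: PAndEl; hyp 0.
(* Set variable 0 becomes [H'], which moves [H] to 1 and the colouring to 2. *)
apply: (@PExSE _ _ (remove_axiom 0 1 0)).
  by apply: (quantifier_free_comprehension _
    (b := remove_form 0 (Var 1) (Var 0))).
apply: (@PExSI _ _ _ 0).
change (prv RCA0 [:: remove_axiom 0 1 0; And (Lt Zero (Var 0)) (In (Var 0) 1);
    And (infinite_form 1) (free_form 1 2); coloring_form 2; FS_form]
  (And (infinite_form 0) (Imp (onto_form 0 2) Bot))).
apply: PAndI.
  apply: (@PImpE _ _ (remove_axiom 0 1 0)); last by hyp 0.
  by apply: PImpE (prv_infinite_remove _ _ 1 _) _; apply: PAndEl; hyp 2.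
apply: (@PImpE _ _ (In (Var 0) 1)); last by apply: PAndEr; hyp 1.
apply: (@PImpE _ _ (free_form 1 2)); last by apply: PAndEr; hyp 2.
by apply: PImpE (prv_remove_not_onto _ 0 _ _ _) _; hyp 0.
Qed.

Theorem theorem3p7 :
  sW_le TS_exact_omega FS_exact_omega /\
  provable RCA0 (Imp FS_form TS_form).
Proof. by split; [exact: TS_sW_le_FS | exact: RCA0_FS_TS]. Qed.
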